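(* Let $p$ be a prime and let $G$ be a $p$-group. Assume that $\pi$ is an irreducible representation of $G$ possessing a full sequence of K-triples $(H_i, r_i, \tau_i)$, $i = 1,\ldots,k$, that are all split. If \[ \sum_{i=2}^k \frac{p^{r_i}-1}{p^{2r_i}} < \frac{1}{2}, \] then $\pi$ does phase retrieval.
   Context: A $p$-group is a finite group of order $p^s$ with $s>0$, $p$ prime. All representations are unitary. For a unitary representation $\pi$ of a finite group $G$ on $\mathcal{H}_\pi$ and $\eta,f\in\mathcal{H}_\pi$ put $V_\eta f(x) = \langle f,\pi(x)\eta\rangle$, $x \in G$. A vector $\eta$ does phase retrieval for $\pi$ if for all $f,g\in\mathcal{H}_\pi$, $|V_\eta f| = |V_\eta g|$ on $G$ implies $f = c\,g$ for some $c\in\mathbb{C}$ with $|c|=1$; $\pi$ does phase retrieval if some $\eta\in\mathcal{H}_\pi$ does. Notation: $[w,y] = w^{-1}y^{-1}wy$; $Z(G)$ is the center of $G$; $Z_1(G) = \{y \in G : yZ(G) \in Z(G/Z(G))\}$; $[G,y] = \{[w,y] : w\in G\}$; $\mathbb{Z}_n = \mathbb{Z}/n\mathbb{Z}$. K-triple: Let $G$ be a $p$-group and $\pi$ an irreducible, faithful representation of $G$. A triple $(G_0,r,\tau)$ is a K-triple for $\pi$ if $r\in\mathbb{N}$, $G_0 \lhd G$, $\tau$ is a representation of $G_0$ with $\pi \simeq \mathrm{ind}_{G_0}^G\tau$, and there exist $x\in G$, $y \in Z_1(G)\setminus Z(G)$, $z \in Z(G)$ such that (i) $[x,y]=z$ and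 $\langle z\rangle = [G,y]\cong \mathbb{Z}_{p^r}$; (ii) $G_0$ is the centralizer of $y$ in $G$; (iii) $G/G_0 = \langle xG_0\rangle \cong \mathbb{Z}_{p^r}$. The K-triple is split if $x$ can be chosen such that $x^{p^r} = e$. Full sequence of K-triples: Let $G$ be a $p$-group and $\pi$ an irreducible representation of $G$. A full sequence of K-triples associated to $\pi$ is a sequence of triples $(H_i,r_i,\tau_i)$, $i=1,\ldots,k$, such that, setting $\tau_0=\pi$, $H_0 = G$ and $K_i = \ker(\tau_i)$ for $i=0,\ldots,k$: for all $0\le i<k$, $(H_{i+1},r_{i+1},\tau_{i+1})$ is a K-triple for the (faithful) representation $\overline{\tau}_i$ of $H_i/K_i$ induced by $\tau_i$; and $H_k/K_k$ is abelian. (So $H_{i+1}$ is a subgroup of $H_i/K_i$, and ''split'' for the $(i+1)$-st triple refers to the group $H_i/K_i$.) *)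

(* Defs.v *)
From mathcomp Require Import all_boot all_order all_fingroup all_solvable.
From mathcomp Require Import all_algebra mxrepresentation.
From mathcomp Require Import reals complex.

Set Implicit Arguments.
Unset Strict Implicit.
Unset Printing Implicit Defensive.

Import GroupScope Order.TTheory GRing.Theory Num.Theory.
Local Open Scope ring_scope.

(* The field of complex numbers is R[i] for R : realType.  A finite-dimensional
   representation on C^n is a matrix representation rho, acting on column
   vectors from the left, so that rho(x) v = rho x *m v.  The library's
   mx_irreducible speaks of row spaces; for unitary rho, U |-> U^* is a
   bijection between invariant row subspaces and invariant column subspaces. *)

Definition nontrivial_pgroup (p : nat) (gT : finGroupType) (G : {group gT}) :=
  p.-group G && (G :!=: 1%g).

Section Unitary.

Variables (R : realType) (gT : finGroupType).
Local Notation C := R[i].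

Definition cdot (n : nat) (u v : 'cV[C]_n) : C := \sum_i u i 0 * (v i 0)^*.

Definition unitary_repr (G : {group gT}) (n : nat)
    (rho : mx_representation C G n) : Prop :=
  forall x, x \in G -> rho x \is unitarymx.

Definition voice (G : {group gT}) (n : nat) (rho : mx_representation C G n)
    (eta f : 'cV[C]_n) (x : gT) : C :=
  cdot f (rho x *m eta).

Definition vector_phase_retrieval (G : {group gT}) (n : nat)
    (rho : mx_representation C G n) (eta : 'cV[C]_n) : Prop :=
  forall f g : 'cV[C]_n,
    (forall x, x \in G -> `|voice rho eta f x| = `|voice rho eta g x|) ->
    exists c : C, `|c| = 1 /\ f = c *: g.

Definition phase_retrieval (G : {group gT}) (n : nat)
    (rho : mx_representation C G n) : Prop :=
  exists eta : 'cV[C]_n, vector_phase_retrieval rho eta.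

(* The Hilbert space of the induced representation ind_H^G tau: functions
   F : G -> C^m with F(x h) = tau(h)^-1 F(x), extended by 0 outside G. *)
Definition ind_space (G H : {group gT}) (m : nat)
    (tau : mx_representation C H m) (F : {ffun gT -> 'cV[C]_m}) : Prop :=
  (forall x h, x \in G -> h \in H -> F (x * h)%g = tau (h^-1)%g *m F x) /\
  (forall x, x \notin G -> F x = 0).

(* The summand is constant on left cosets of H, so this is the sum over G / H. *)
Definition ind_cdot (G H : {group gT}) (m : nat)
    (F1 F2 : {ffun gT -> 'cV[C]_m}) : C :=
  #|H|%:R^-1 * \sum_(x in G) cdot (F1 x) (F2 x).

(* rho is unitarily equivalent to ind_H^G tau, where G acts on ind_space by
   left translation. *)
Definition equiv_ind (G H : {group gT}) (n m : nat)
    (rho : mx_representation C G n) (tau : mx_representation C H m) : Prop :=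
  exists T : {linear 'cV[C]_n -> {ffun gT -> 'cV[C]_m}},
    [/\ forall v, ind_space G tau (T v),
        forall F, ind_space G tau F -> exists v, T v = F,
        forall u v, ind_cdot G H (T u) (T v) = cdot u v
      & forall x v, x \in G ->
          T (rho x *m v) = [ffun w => T v (x^-1 * w)%g]].

Definition Z1 (G : {group gT}) : {set gT} :=
  [set y in G | coset 'Z(G) y \in 'Z(G / 'Z(G))].

Definition K_witness (p : nat) (G H : {group gT}) (r : nat) (x y z : gT)
    : Prop :=
  [/\ [/\ x \in G, y \in Z1 G :\: 'Z(G) & z \in 'Z(G)],
      [/\ [~ x, y] = z, <[z]> = [set [~ w, y] | w in G]
        & <[z]> \isog Zp (p ^ r)],
      H :=: 'C_G[y]
    & (G / H)%g = <[coset H x]> /\ (G / H)%g \isog Zp (p ^ r)].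

Definition K_triple (p : nat) (G : {group gT}) (n : nat)
    (rho : mx_representation C G n) (H : {group gT}) (r m : nat)
    (tau : mx_representation C H m) : Prop :=
  [/\ [/\ nontrivial_pgroup p G, unitary_repr rho, mx_irreducible rho
        & mx_faithful rho],
      H <| G,
      unitary_repr tau,
      equiv_ind rho tau
    & exists x y z, K_witness p G H r x y z].

(* Splitness depends on the groups and r only. *)
Definition K_split (p : nat) (G H : {group gT}) (r : nat) : Prop :=
  exists x y z, K_witness p G H r x y z /\ (x ^+ (p ^ r))%g = 1%g.

End Unitary.

(* A full sequence (H_1, r_1, tau_1), ..., (H_k, r_k, tau_k) associated to rho.
   As H_{i+1} is a subgroup of H_i / ker tau_i, the ambient finite group type
   changes at every step: FullCons carries (H_1, r_1, tau_1) together with the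
   remaining triples, which form a full sequence associated to tau_1. *)
Inductive full_sequence (R : realType) (p : nat) (gT : finGroupType)
    (G : {group gT}) (n : nat) (rho : mx_representation R[i] G n) : Type :=
  | FullNil of abelian (G / rker rho)
  | FullCons (H : {group coset_of (rker rho)}) (r m : nat)
      (tau : mx_representation R[i] H m) of
      K_triple p (kquo_repr rho) r tau & full_sequence p tau.

Fixpoint seq_r (R : realType) (p : nat) (gT : finGroupType)
    (G : {group gT}) (n : nat) (rho : mx_representation R[i] G n)
    (s : full_sequence p rho) : seq nat :=
  match s with
  | FullNil _ => [::]
  | FullCons _ r _ _ _ s' => r :: seq_r s'
  end.

Fixpoint all_split (R : realType) (p : nat) (gT : finGroupType)
    (G : {group gT}) (n : nat) (rho : mx_representation R[i] G n)
    (s : full_sequence p rho) : Prop :=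
  match s with
  | FullNil _ => True
  | FullCons H r _ _ _ s' => K_split p (G / rker rho)%G H r /\ all_split s'
  end.

(* Main.v *)
Require Import Defs.
From mathcomp Require Import all_boot all_order all_fingroup all_solvable.
From mathcomp Require Import all_algebra mxrepresentation.
From mathcomp Require Import reals complex.
From mathcomp Require Import zify ring lra.
Import GroupScope Order.TTheory GRing.Theory Num.Theory.
Local Open Scope ring_scope.

Set Implicit Arguments.
Unset Strict Implicit.
Unset Printing Implicit Defensive.

(* For a split K-triple with q = p^r, the elements x and y act on ind tau like
   the translation and the modulation of a Heisenberg group over Z/q, while
   each fibre f_j (j in Z/q) of a vector f carries a conjugate of tau.  Take
   eta with fibres eta_j = w_j zeta.  Up to a nonzero factor depending on l
   only, the voice transform of f at y^l h x^k is the Gabor coefficient at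
   (k, l), with window w, of the vector A(h) of the numbers
   A_j(h) = V_zeta(f_j)(h^(x^j)).

   For a suitable w, (a) a nonzero vector has at most q - 1 vanishing Gabor
   coefficients among q^2, and (b) the moduli of the coefficients of a vector a
   determine all products a_i a_j^*.  By (a), the proportion of zeros of a voice
   transform grows by at most (q - 1) / q^2 at each level.  By (b), if zeta does
   phase retrieval for tau then f is known up to one phase per fibre; two such
   phases are compared at a point h where the two fibre transforms are both
   nonzero, which exists as soon as each of them vanishes on less than half of
   H.  The hypothesis on the sum guarantees exactly this at the first level, and
   hence at the deeper ones. *)

(** * A window of full spark *)

(** Twice the trapezoidal rule for the integral of [k] from [0] to [j]; the doubling keeps it in
    [nat]. *)
Definition trapezoid (k : nat -> nat) (j : nat) : nat :=
  (\sum_(i < j) (k i + k i.+1))%N.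

Lemma trapezoidS k j : trapezoid k j.+1 = (trapezoid k j + (k j + k j.+1))%N.
Proof. by rewrite /trapezoid big_ord_recr. Qed.

(* [trapezoid k] is convex with subgradient [2 * k c] at [c]. *)
Lemma trapezoid_gap (k : nat -> nat) (j c : nat) :
  {homo k : i1 i2 / (i1 <= i2)%N} ->
  (2 * j * k c + trapezoid k c + ((k j - k c) + (k c - k j))
     <= trapezoid k j + 2 * c * k c)%N.
Proof.
move=> kmono; case: (leqP c j) => [lecj | /ltnW lejc].
- have -> : j = (c + (j - c))%N by lia.
  elim: (j - c)%N => [|d IH]; first by rewrite addn0; lia.
  rewrite addnS trapezoidS.
  have := kmono c (c + d)%N (leq_addr _ _).
  have := kmono (c + d)%N (c + d).+1 (leqnSn _).
  nia.
- rewrite -(subKn lejc).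
  elim: (c - j)%N (leq_subr j c) => [|d IH] dle; first by rewrite subn0; lia.
  have {}IH := IH (ltnW dle).
  have E : (c - d)%N = (c - d.+1).+1 by lia.
  rewrite E trapezoidS in IH.
  have H1 := kmono (c - d.+1)%N c (leq_subr _ _).
  have := kmono (c - d.+1).+1 c.
  rewrite -E leq_subr => /(_ isT) H2.
  rewrite -E in IH.
  have := kmono (c - d.+1)%N (c - d)%N; rewrite E leqnSn -E => /(_ isT) H3.
  nia.
Qed.

Lemma trapezoid_eq (k : nat -> nat) (j c : nat) :
  {homo k : i1 i2 / (i1 <= i2)%N} -> k j = k c ->
  (trapezoid k j + 2 * c * k c = 2 * j * k c + trapezoid k c)%N.
Proof.
move=> kmono E.
have := trapezoid_gap j c kmono; have := trapezoid_gap c j kmono.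
rewrite E; lia.
Qed.

(* Exponents of the window: convex, and with a linear part steep enough to
   penalise every wrap-around modulo [N]. *)
Definition wexp (N d : nat) : nat := (d * d + N * d)%N.

Section Slack.

Variables (N : nat) (k : nat -> nat).
Hypothesis kmono : {homo k : i1 i2 / (i1 <= i2)%N}.
Hypothesis kN : forall i, (k i < N)%N.
Hypothesis kle : forall i, (i < N)%N -> (k i <= i)%N.

(* Reduced cost of pairing row [j] with column [c], for the dual potentials of
   the optimal pairing [j = c] in the assignment problem of cost [wexp]. *)
Definition slack (j c : nat) : nat :=
  (wexp N ((j + N - k c) %% N) + trapezoid k j + (N * k c + 2 * c * k c)
     - (j * j + N * j) - (k c * k c + trapezoid k c))%N.

Lemma modn_wrap j c : (j < N)%N ->
  ((j + N - k c) %% N = if k c <= j then j - k c else j + N - k c)%N.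
Proof.
move=> jN; case: leqP => kj; last by rewrite modn_small //; lia.
have -> : (j + N - k c = (j - k c) + N)%N by lia.
by rewrite modnDr modn_small //; lia.
Qed.

(** The subtractions in [slack] are never truncated: without wrap-around the slack is the gap of
    [trapezoid_gap], and a wrap-around adds [2 * N] times the residue [j + N - k c]. *)
Lemma slackE j c : (j < N)%N ->
  (wexp N ((j + N - k c) %% N) + trapezoid k j + (N * k c + 2 * c * k c)
     = slack j c + (j * j + N * j) + (k c * k c + trapezoid k c))%N.
Proof.
move=> jN; rewrite /slack modn_wrap //.
have := trapezoid_gap j c kmono; have := kN c.
move: (trapezoid k j) (trapezoid k c) => a b.
rewrite /wexp => kN' H.
suff le : (j * j + N * j + (k c * k c + b)
    <= (if k c <= j then j - k c else j + N - k c)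
       * (if k c <= j then j - k c else j + N - k c)
     + N * (if k c <= j then j - k c else j + N - k c)
     + (a + (N * k c + 2 * c * k c)))%N by lia.
case: (leqP (k c) j) => kj.
  have [e je] : exists e, j = (k c + e)%N by exists (j - k c)%N; rewrite subnKC.
  have -> : (j - k c = e)%N by rewrite je addKn.
  have {H}: (2 * j * k c + b <= a + 2 * c * k c)%N by lia.
  rewrite je; nia.
have {H}: (2 * j * k c + b <= a + 2 * c * k c)%N by lia.
have [e ke] : exists e, k c = (j + e)%N by exists (k c - j)%N; rewrite subnKC // ltnW.
have [f Nf] : exists f, N = (e + f)%N by exists (N - e)%N; lia.
have -> : (j + N - k c = f)%N by lia.
rewrite ke Nf; nia.
Qed.

(** If [k j = k c], then [kle] excludes a wrap-around and [trapezoid_eq] applies; otherwise the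
    distance term in [trapezoid_gap] makes the gap positive. *)
Lemma slack_eq0 j c : (j < N)%N -> (slack j c == 0%N) = (k j == k c).
Proof.
move=> jN; have := slackE c jN; rewrite modn_wrap //.
have := trapezoid_gap j c kmono; have := kN c.
have := @trapezoid_eq k j c kmono; have := kle jN.
move: (trapezoid k j) (trapezoid k c) (slack j c) => a b s.
rewrite /wexp; case: (eqVneq (k j) (k c)) => [E kj /(_ E) H kN' _ | nE kj _ kN' H].
  have kcj : (k c <= j)%N by rewrite -E.
  rewrite kcj => H2; apply/eqP.
  have [e je] : exists e, j = (k c + e)%N.
    by exists (j - k c)%N; rewrite subnKC.
  have E1 : (j - k c = e)%N by rewrite je addKn.
  by rewrite E1 je in H H2; nia.
have {}H : (2 * j * k c + b < a + 2 * c * k c)%N by lia.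
case: (leqP (k c) j) => kj' H2; apply/negbTE/eqP.
  have [e je] : exists e, j = (k c + e)%N.
    by exists (j - k c)%N; rewrite subnKC.
  have E1 : (j - k c = e)%N by rewrite je addKn.
  by rewrite E1 je in H H2; nia.
have [e ke] : exists e, k c = (j + e)%N.
  by exists (k c - j)%N; rewrite subnKC // ltnW.
have [f Nf] : exists f, N = (e + f)%N by exists (N - e)%N; lia.
have E1 : (j + N - k c = f)%N by lia.
rewrite E1 ke Nf in H2 H *; nia.
Qed.

End Slack.

(** * Nonvanishing of Gabor determinants *)

Lemma card_ord_interval n (i j : 'I_n) : (i <= j)%N ->
  (j - i < #|[set x : 'I_n | i <= x <= j]|)%N.
Proof.
move=> leij.
pose f (d : 'I_(j - i).+1) : 'I_n := insubd i (i + d)%N.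
have fE d : f d = (i + d)%N :> nat.
  by rewrite /f val_insubd; case: ifP => //; have := ltn_ord d; have := ltn_ord j; lia.
have finj : injective f.
  by move=> d1 d2 /(congr1 val); rewrite /= !fE => /addnI /val_inj.
rewrite -[X in (X <= _)%N]card_ord -(card_imset _ finj).
apply/subset_leq_card/subsetP => _ /imsetP[d _ ->].
by rewrite inE fE; have := ltn_ord d; lia.
Qed.

Section Spark.

Variables (C : numClosedFieldType) (n : nat) (w : C).
Local Notation N := n.+1.
Hypothesis wprim : N.-primitive_root w.

Lemma prim_expr_inj (i j : 'I_N) : w ^+ i = w ^+ j -> i = j.
Proof.
move/eqP; rewrite (eq_prim_root_expr wprim) !modn_small ?ltn_ord // => /eqP.
exact: val_inj.
Qed.

(* A Vandermonde argument: on an interval of rows, the columns are powers of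
   distinct nodes. *)
Lemma vandermonde_interval (J : {set 'I_N}) (l : 'I_N -> 'I_N) (a : 'I_N -> C) :
  (forall i j x : 'I_N, i \in J -> j \in J -> (i <= x <= j)%N -> x \in J) ->
  {in J &, injective l} ->
  (forall c, c \in J -> \sum_(j in J) a j * w ^+ (j * l c) = 0) ->
  forall j, j \in J -> a j = 0.
Proof.
move=> Jint linj aJ j0 j0J.
have [s sJ smin] : exists2 s : 'I_N, s \in J & forall j, j \in J -> (s <= j)%N.
  by case: (arg_minnP (fun j : 'I_N => j : nat) j0J) => s; exists s.
have Jlt j : j \in J -> (j - s < #|J|)%N.
  move=> jJ; apply: leq_trans (card_ord_interval (smin _ jJ)) _.
  by apply/subset_leq_card/subsetP => x; rewrite inE; apply: Jint.
(* Subtracting the least index [s] factors out [w ^+ (s * l c)] and keeps the degree below [#|J|],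
   the number of roots. *)
pose P := \sum_(j in J) a j *: 'X^(j - s) : {poly C}.
have szP : (size P <= #|J|)%N.
  apply: (leq_trans (size_sum _ _ _)); apply/bigmax_leqP => j jJ.
  apply: (leq_trans (size_scale_leq _ _)); rewrite size_polyXn; exact: Jlt.
have P0 : P = 0.
  apply/eqP/negP => /negP P_neq0.
  pose rs := [seq w ^+ l c | c <- enum J].
  suff: (size rs < size P)%N by rewrite size_map -cardE ltnNge szP.
  apply: (max_poly_roots P_neq0).
  - apply/allP => x /mapP[c]; rewrite mem_enum => cJ ->.
    rewrite rootE; have := aJ c cJ.
    rewrite -[X in X = 0](_ : w ^+ (s * l c) * P.[w ^+ l c] = _).
      move/eqP; rewrite mulf_eq0 expf_eq0 (prim_root_eq0 wprim) andbF /=.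
      by move/eqP->.
    rewrite horner_sum big_distrr /=; apply: eq_bigr => j jJ.
    rewrite hornerZ hornerXn -exprM mulrCA -exprD; congr (_ * _ ^+ _).
    by rewrite [(l c * _)%N]mulnC -mulnDl subnKC // smin.
  - rewrite map_inj_in_uniq ?enum_uniq // => c1 c2.
    by rewrite !mem_enum => c1J c2J /prim_expr_inj/linj; apply.
have := coef0 C (j0 - s)%N; rewrite -P0 coef_sum (bigD1 j0) //=.
rewrite coefZ coefXn eqxx mulr1 big1 ?addr0 // => j /andP[jJ jj0].
rewrite coefZ coefXn (_ : (_ == _) = false) ?mulr0 //.
apply: contraNF jj0 => /eqP E; apply/eqP/val_inj.
by have := smin _ jJ; have := smin _ j0J; rewrite /=; lia.
Qed.

(* The factor [1 + 'i] only serves [corr_poly_neq0]: with a real window, the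
   correlation at the shift [N / 2] vanishes for odd modulations. *)
Definition theta (d : nat) : C := if d == 0%N then 1 else 1 + 'i.

Lemma theta_neq0 d : theta d != 0.
Proof.
rewrite /theta; case: ifP => _; first exact: oner_neq0.
apply/eqP => /eqP; rewrite addrC addr_eq0 => /eqP/(congr1 (fun x => x ^+ 2)).
by rewrite sqrCi sqrrN expr1n => /eqP; rewrite eq_sym -addr_eq0 -mulr2n pnatr_eq0.
Qed.

Definition window_poly (d : nat) : {poly C} := theta d *: 'X^(wexp N d).

(** The columns are time-frequency shifts of the window. Entries stay polynomials so that one value
    of ['X] can serve all determinants at once. *)
Definition gabor_mx (k l : 'I_N -> 'I_N) : 'M[{poly C}]_N :=
  \matrix_(j, c) (w ^+ (j * l c) *: window_poly ((j + N - k c) %% N)).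

(* Rescaling rows and columns by powers of ['X] given by the potentials turns the
   matrix into one which at ['X = 0] is block diagonal with Vandermonde blocks. *)
Lemma det_gabor_neq0 (k l : 'I_N -> 'I_N) :
  {homo k : i j / (i <= j)%N} -> (forall i, (k i <= i)%N) ->
  injective (fun c => (k c, l c)) -> \det (gabor_mx k l) != 0.
Proof.
move=> kmono kle klinj.
(* [slack] takes a function on [nat]: [k] is continued by its last value, which keeps it
   monotone. *)
pose kk (i : nat) : nat := k (inord (minn i n)).
have kkE (i : 'I_N) : kk i = k i.
  by rewrite /kk (minn_idPl _) ?inord_val // -ltnS.
have kkmono : {homo kk : i j / (i <= j)%N}.
  by move=> i j ij; apply: kmono; rewrite !inordK ?ltnS ?geq_minr //; lia.
have kkN i : (kk i < N)%N by apply: ltn_ord.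
have kkle i : (i < N)%N -> (kk i <= i)%N.
  by move=> iN; have := kle (Ordinal iN); rewrite -kkE.
pose U := trapezoid kk.
pose Q : 'M[{poly C}]_N := \matrix_(j, c)
  ((w ^+ (j * l c) * theta ((j + N - k c) %% N)) *: 'X^(slack N kk j c)).
pose D1 : 'M[{poly C}]_N := diag_mx (\row_j 'X^(U j)).
pose D2 : 'M[{poly C}]_N := diag_mx (\row_c 'X^(N * k c + 2 * c * k c)).
pose D3 : 'M[{poly C}]_N := diag_mx (\row_j 'X^(j * j + N * j)).
pose D4 : 'M[{poly C}]_N := diag_mx (\row_c 'X^(k c * k c + U c)).
have E : D1 *m gabor_mx k l *m D2 = D3 *m Q *m D4.
  apply/matrixP => j c; rewrite !mul_mx_diag !mul_diag_mx !mxE.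
  rewrite /window_poly scalerA -!scalerAr -!scalerAl -!exprD; congr (_ *: 'X^_).
  have := slackE kkmono kkN c (ltn_ord j); rewrite !kkE /U; lia.
suff Qn0 : \det Q != 0.
  apply: contra_neq Qn0 => E0; move/(congr1 determinant): E.
  rewrite !det_mulmx E0 mulr0 mul0r => /esym/eqP.
  rewrite !mulf_eq0 !det_diag => /orP[/orP[|/eqP//]|];
    by move/prodf_eq0 => [i _]; rewrite mxE -size_poly_eq0 size_polyXn.
pose E0 : 'M[C]_N := \matrix_(j, c)
  ((w ^+ (j * l c) * theta ((j + N - k c) %% N)) * (k j == k c)%:R).
have QE : map_mx (horner_eval 0) Q = E0.
  apply/matrixP => j c; rewrite !mxE /= /horner_eval hornerZ hornerXn expr0n.
  by rewrite (slack_eq0 kkmono kkN kkle) // !kkE.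
suff : \det E0 != 0.
  by rewrite -QE det_map_mx; apply: contraNneq => ->; rewrite rmorph0.
apply/det0P => -[v vn0 vE]; case/negP: vn0; apply/eqP/rowP => j0; rewrite [RHS]mxE.
(* The kernel vector is killed block by block: the level set [J] of [k] is an interval on which [l]
   is injective, and in this block [theta] depends on the row only, so [a] absorbs it. *)
pose J := [set j | k j == k j0].
pose a j := v 0 j * theta ((j + N - k j0) %% N).
suff : a j0 = 0 by move/eqP; rewrite mulf_eq0 (negbTE (theta_neq0 _)) orbF => /eqP.
apply: (@vandermonde_interval J l a); last by rewrite inE.
- move=> i j x; rewrite !inE => /eqP ki /eqP kj /andP[ix xj].
  have := kmono _ _ ix; have := kmono _ _ xj; rewrite ki kj => le1 le2.
  by apply/eqP/val_inj/eqP; rewrite eqn_leq le1 le2.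
- move=> c1 c2; rewrite !inE => /eqP k1 /eqP k2 l12; apply: klinj.
  by rewrite k1 k2 l12.
- move=> c; rewrite inE => /eqP kc.
  have := congr1 (fun M : 'rV_N => M 0 c) vE; rewrite !mxE => vc.
  rewrite -[RHS]vc big_mkcond; apply: eq_bigr => j _.
  rewrite mxE inE kc; case: eqP => _; last by rewrite !mulr0.
  by rewrite mulr1 /a -mulrA; congr (_ * _); rewrite mulrC.
Qed.

End Spark.

(** * Choice of [N] columns in staircase position *)

(* The cycle lemma: start right after the minimum of the partial sums of
   [cnt i - 1]. *)
Lemma ballot_rotation n (cnt : nat -> nat) :
  (\sum_(i < n.+1) cnt i = n.+1)%N ->
  exists s : 'I_n.+1, forall m, (m <= n.+1)%N ->
    (m <= \sum_(i < m) cnt ((s + i) %% n.+1))%N.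
Proof.
set N := n.+1 => cntN.
pose g m := (\sum_(i < m) cnt (i %% N))%N.
have gD s m : g (s + m)%N = (g s + \sum_(i < m) cnt ((s + i) %% N))%N.
  by rewrite /g big_split_ord.
have gN : g N = N.
  by rewrite -[RHS]cntN; apply: eq_bigr => i _; rewrite modn_small.
have gDN m : g (N + m)%N = (N + g m)%N.
  by rewrite gD gN; congr addn; apply: eq_bigr => i _; rewrite modnDl.
(* The quantity minimised is the partial sum of [cnt i - 1], shifted by [N] to remain in [nat]. *)
have [s _ smin] := arg_minnP (fun i : 'I_N => (g i + (N - i))%N) (erefl (xpredT ord0)).
exists s => m leNm; rewrite -(leq_add2l (g s)) -gD.
have sN := ltn_ord s; case: (ltnP (s + m) N) => smN.
  by have := smin (Ordinal smN) isT; rewrite /=; lia.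
have -> : (s + m = N + (s + m - N))%N by lia.
have smN' : (s + m - N < N)%N by lia.
by rewrite gDN; have := smin (Ordinal smN') isT; rewrite /=; lia.
Qed.

Lemma ordB_if n (i j : 'I_n.+1) :
  (i - j)%R = (if (j <= i)%N then i - j else i + n.+1 - j)%N :> nat.
Proof.
have iN := ltn_ord i; have jN := ltn_ord j.
rewrite /= modnDmr; case: leqP => ij; last by rewrite modn_small //; lia.
have -> : (i + (n.+1 - j) = (i - j) + n.+1)%N by lia.
by rewrite modnDr modn_small //; lia.
Qed.

Lemma ordBE n (i j : 'I_n.+1) : (i - j)%R = ((i + n.+1 - j) %% n.+1)%N :> nat.
Proof. by rewrite /= modnDmr addnBA // ltnW. Qed.

Lemma card_set_sum (T : finType) (A : {set T}) (P : pred T) :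
  #|[set x in A | P x]| = (\sum_(x in A) P x)%N.
Proof.
rewrite -sum1_card (eq_bigl (fun x => (x \in A) && P x)) => [|x]; last by rewrite inE.
by rewrite big_mkcondr; apply: eq_bigr => x _; case: (P x).
Qed.

(** Sort [L] by first coordinate. If the entry at position [i] had first coordinate above [i], all
    those with first coordinate at most [i] would precede it, hence number at most [i], against the
    hypothesis for [i.+1]. *)
Lemma sorted_columns n (L : {set 'I_n.+1 * 'I_n.+1}) :
  #|L| = n.+1 ->
  (forall m, (m <= n.+1)%N -> (m <= #|[set x in L | (x.1 < m)%N]|)%N) ->
  exists k l : 'I_n.+1 -> 'I_n.+1,
    [/\ {homo k : i j / (i <= j)%N}, forall i, (k i <= i)%N,
        injective (fun c => (k c, l c)) & forall c, (k c, l c) \in L].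
Proof.
move=> cardL Lge.
pose le (x y : 'I_n.+1 * 'I_n.+1) := (x.1 <= y.1)%N.
pose sq := sort le (enum L).
have szsq : size sq = n.+1 by rewrite size_sort -cardE.
have usq : uniq sq by rewrite sort_uniq enum_uniq.
have memsq x : (x \in sq) = (x \in L) by rewrite mem_sort mem_enum.
pose f (c : 'I_n.+1) := nth (ord0, ord0) sq c.
have finj : injective f.
  move=> c1 c2 /eqP; rewrite nth_uniq ?szsq // => /eqP; exact: val_inj.
have fL c : f c \in L by rewrite -memsq mem_nth ?szsq.
have fmono : {homo (fun c => (f c).1) : i j / (i <= j)%N}.
  move=> i j ij; apply: (@sorted_leq_nth _ le) => //; rewrite ?inE ?szsq //.
  - by move=> x y z; apply: leq_trans.
  - by move=> x; apply: leqnn.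
  - by apply: sort_sorted => x y; apply: leq_total.
exists (fun c => (f c).1), (fun c => (f c).2); split=> //.
- move=> i; rewrite leqNgt; apply/negP => lti.
  have := Lge i.+1 (ltn_ord i); apply/negP; rewrite -ltnNge ltnS.
  have -> : [set x in L | (x.1 < i.+1)%N] = f @: [set c | ((f c).1 < i.+1)%N].
    apply/setP => x; rewrite !inE; apply/andP/imsetP => [[xL xi] | [c]].
      have : x \in sq by rewrite memsq.
      case/(nthP (ord0, ord0)) => c; rewrite szsq => cN cE.
      by exists (Ordinal cN); rewrite ?inE /f /= cE.
    by rewrite inE => ci ->; split.
  rewrite card_imset //.
  have sub : [set c | ((f c).1 < i.+1)%N] \subset [set c : 'I_n.+1 | (c < i)%N].
    apply/subsetP => c; rewrite !inE ltnS => ci; rewrite ltnNge; apply/negP => ic.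
    by have := leq_trans lti (leq_trans (fmono _ _ ic) ci); rewrite ltnn.
  apply: (leq_trans (subset_leq_card sub)).
  have le_in := ltnW (ltn_ord i).
  have winj : injective (widen_ord le_in).
    by move=> a b /(congr1 val) /= /val_inj.
  rewrite -[X in (_ <= X)%N](card_ord i) -(card_imset _ winj).
  apply/subset_leq_card/subsetP => c; rewrite inE => ci.
  by apply/imsetP; exists (Ordinal ci) => //; apply: val_inj.
- by move=> c1 c2 E; apply: finj; rewrite [f c1]surjective_pairing [f c2]surjective_pairing.
- by move=> c; rewrite -surjective_pairing.
Qed.

(** An arbitrary [L] may fail the counting hypothesis of [sorted_columns]; the cycle lemma provides
    a common shift [s] of the translations that restores it. *)
Lemma rotated_columns n (L : {set 'I_n.+1 * 'I_n.+1}) :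
  #|L| = n.+1 ->
  exists (s : 'I_n.+1) (k l : 'I_n.+1 -> 'I_n.+1),
    [/\ {homo k : i j / (i <= j)%N}, forall i, (k i <= i)%N,
        injective (fun c => (k c, l c)) & forall c, (s + k c, l c) \in L].
Proof.
move=> cardL.
pose cnt i := #|[set x in L | x.1 == i :> nat]|.
have cntE (h : 'I_n.+1 * 'I_n.+1 -> nat) m :
    #|[set x in L | (h x < m)%N]| = (\sum_(i < m) #|[set x in L | h x == i]|)%N.
  rewrite card_set_sum; elim: m => [|m IH].
    by rewrite big_ord0 big1.
  rewrite big_ord_recr /= -IH card_set_sum -big_split /=; apply: eq_bigr => x _.
  by rewrite ltnS leq_eqVlt; case: ltngtP.
have [|s sP] := @ballot_rotation n cnt.
  rewrite -(cntE (fun x => x.1)) -[RHS]cardL; congr #|pred_of_set _|; apply/setP => x.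
  by rewrite inE ltn_ord andbT.
pose f (x : 'I_n.+1 * 'I_n.+1) := (x.1 - s, x.2).
have finj : injective f.
  move=> [x1 x2] [y1 y2] E.
  have /addIr -> : x1 - s = y1 - s := congr1 fst E.
  by have -> : x2 = y2 := congr1 snd E.
have [||k [l [kmono kle klinj kL]]] := @sorted_columns n (f @: L).
- by rewrite card_imset.
- move=> m mN; apply: (leq_trans (sP m mN)).
  have -> : [set x in f @: L | (x.1 < m)%N] = f @: [set x in L | ((x.1 - s)%R < m)%N].
    apply/setP => x; rewrite !inE; apply/andP/imsetP => [[/imsetP[y yL ->] xm] | [y]].
      by exists y; rewrite ?inE ?yL.
    by rewrite inE => /andP[yL ym] ->; rewrite imset_f.
  rewrite card_imset // (cntE (fun x => (x.1 - s)%R : nat)).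
  apply: eq_leq; apply: eq_bigr => i _; congr #|pred_of_set _|; apply/setP => x.
  rewrite !inE; congr (_ && _); rewrite ordB_if.
  have im := ltn_ord i; have sN := ltn_ord s; have xN := ltn_ord x.1.
  have -> : ((s + i) %% n.+1 = if s + i < n.+1 then s + i else s + i - n.+1)%N.
    case: ltnP => si; first by rewrite modn_small.
    have {1}-> : (s + i = (s + i - n.+1) + n.+1)%N by lia.
    by rewrite modnDr modn_small //; lia.
  move: (nat_of_ord i) (nat_of_ord s) (nat_of_ord x.1) im sN xN => i' s' x' *.
  by case: (ltnP (s' + i')%N); case: (leqP s' x'); lia.
exists s, k, l; split=> // c.
have /imsetP[[x1 x2] xL E] := kL c.
have -> : k c = x1 - s := congr1 fst E.
have -> : l c = x2 := congr1 snd E.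
by rewrite addrC subrK.
Qed.

(** * The numerical window: full spark and recovery of products from moduli *)

Lemma wexp_mono N d1 d2 : (d1 <= d2)%N -> (wexp N d1 <= wexp N d2)%N.
Proof. by move=> le; rewrite /wexp leq_add ?leq_mul. Qed.

Lemma wexp_ltn N d1 d2 : (d1 < d2)%N -> (wexp N d1 < wexp N d2)%N.
Proof. by move=> lt; rewrite /wexp -addSn leq_add ?ltn_mul ?leq_mul // ltnW. Qed.

Lemma exists_nat_nonroot (F : numFieldType) (P : {poly F}) :
  P != 0 -> exists r : nat, P.[r%:R] != 0.
Proof.
move=> P_neq0; pose rs := [seq i%:R : F | i <- iota 0 (size P)].
have /allPn[_ /mapP[i _ ->] ri] : ~~ all (root P) rs.
  apply/negP => /(max_poly_roots P_neq0); rewrite size_map size_iota ltnn.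
  by rewrite map_inj_uniq ?iota_uniq => [/(_ isT)|i j /eqP] //; rewrite eqr_nat => /eqP.
by exists i; rewrite -rootE.
Qed.

Section Window.

Variables (C : numClosedFieldType) (n : nat) (w : C).
Local Notation N := n.+1.
Hypothesis wprim : N.-primitive_root w.

Lemma prim_norm1 : `|w| = 1.
Proof.
have := congr1 (@Num.norm _ C) (prim_expr_order wprim).
by rewrite normrX normr1 => /eqP; rewrite pexpr_eq1 ?normr_ge0 // => /eqP.
Qed.

Lemma prim_conj_mul m : w ^+ m * (w ^+ m)^* = 1.
Proof. by rewrite -normCK normrX prim_norm1 !expr1n. Qed.

Lemma prim_exprD (i j : 'I_N) l :
  w ^+ ((i + j)%R * l)%N = w ^+ (i * l) * w ^+ (j * l).
Proof. by rewrite exprM /= (prim_expr_mod wprim) -exprM mulnDl exprD. Qed.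

Lemma prim_exprB (i j : 'I_N) l :
  w ^+ ((i - j)%R * l)%N = w ^+ (i * l) * (w ^+ (j * l))^*.
Proof.
by rewrite -[in RHS](subrK j i) [in RHS]prim_exprD -mulrA prim_conj_mul mulr1.
Qed.

Lemma fourier_inj (D : 'I_N -> C) :
  (forall m : 'I_N, \sum_(j < N) w ^+ (j * m) * D j = 0) -> forall j, D j = 0.
Proof.
move=> DF j; apply: (@vandermonde_interval C n w wprim setT id D); rewrite ?inE //.
  by move=> i k x; rewrite !inE.
move=> c _.
 rewrite -[RHS](DF c); apply: eq_big => i; first by rewrite inE.
by rewrite mulrC.
Qed.

(** The ambiguity function of the polynomial window, with ['X] treated as real: only the factors
    [theta] are conjugated. *)
Definition corr_poly (s m : 'I_N) : {poly C} :=
  \sum_(k < N) (w ^+ (m * k) * theta C (k + s)%R * (theta C k)^*)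
                 *: 'X^(wexp N (k + s)%R + wexp N k).

Lemma coef_corr_poly (s m : 'I_N) e : (corr_poly s m)`_e =
  \sum_(k < N | e == (wexp N (k + s)%R + wexp N k)%N)
    w ^+ (m * k) * theta C (k + s)%R * (theta C k)^*.
Proof.
rewrite coef_sum [RHS]big_mkcond; apply: eq_bigr => k _.
by rewrite coefZ coefXn; case: ifP; rewrite ?mulr1 ?mulr0.
Qed.

Lemma ordD_if (i j : 'I_N) :
  (i + j)%R = (if (i + j < N)%N then i + j else i + j - N)%N :> nat.
Proof.
have iN := ltn_ord i; have jN := ltn_ord j.
rewrite /=; case: ltnP => ij; first by rewrite modn_small.
have {1}-> : (i + j = (i + j - N) + N)%N by lia.
by rewrite modnDr modn_small //; lia.
Qed.

(** Without wrap-around [k + s] is at least [s], so only [k = 0] avoids an excess. With wrap-around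
    [k >= N - s >= s], and equality forces [k = s] and [2 * s = N]. *)
Lemma corr_exp_small (s k : 'I_N) : (2 * s <= N)%N ->
  (wexp N s == wexp N (k + s)%R + wexp N k)%N
    = (k == 0) || ((2 * s == N)%N && (k == s)).
Proof.
move=> sN; rewrite -!val_eqE ordD_if /=.
have kN := ltn_ord k; have sltN := ltn_ord s.
have w0 : wexp N 0 = 0%N by rewrite /wexp !muln0.
have wk := @wexp_ltn N 0 k; rewrite w0 in wk.
case: ltnP => ks.
  have := @wexp_mono N s (k + s) (leq_addl _ _).
  case: (posnP k) => [-> | k0]; first by rewrite add0n w0 addn0 eqxx.
  by have := wk k0; lia.
have := @wexp_ltn N s k; have := @wexp_mono N s k.
have := @wexp_ltn N 0 (k + s - N); rewrite w0.
case: (ltngtP (s : nat) (k : nat)) => sk; [lia | lia |].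
rewrite -sk (_ : (s + s - N = 0)%N) ?w0; lia.
Qed.

(** Without wrap-around [k + s] already exceeds [N - s]; with it, [k] is at least [N - s], the value
    at which the other term vanishes. *)
Lemma corr_exp_large (s k : 'I_N) : (N < 2 * s)%N ->
  (wexp N (N - s) == wexp N (k + s)%R + wexp N k)%N = (k == - s).
Proof.
move=> sN; have sltN := ltn_ord s.
have Ns : (- s)%R = (N - s)%N :> nat by rewrite /= modn_small //; lia.
rewrite -val_eqE [val (- s)]Ns ordD_if [val k]/=.
have kN := ltn_ord k.
have w0 : wexp N 0 = 0%N by rewrite /wexp !muln0.
case: ltnP => ks.
  have lt : (N - s < k + s)%N by lia.
  have := wexp_ltn N lt; rewrite (_ : (nat_of_ord k == N - s)%N = false); lia.
case: (eqVneq (k : nat) (N - s)%N) => [-> | ne]; last first.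
  have lt : (N - s < k)%N by lia.
  by have := wexp_ltn N lt; lia.
by rewrite (_ : (N - s + s - N = 0)%N) ?w0 ?add0n ?eqxx //; lia.
Qed.

(* The lowest exponent is attained at [k = 0] or [k = - s] only, and at both of
   them exactly when [2 s = N]. *)
Lemma corr_poly_neq0 (s m : 'I_N) : corr_poly s m != 0.
Proof.
have w_neq0 j : w ^+ j != 0 by rewrite expf_eq0 (prim_root_eq0 wprim) andbF.
suff [e e_neq0] : exists e, (corr_poly s m)`_e != 0.
  by apply: contraNneq e_neq0 => ->; rewrite coef0.
case: (ltnP N (2 * s)) => sN.
  exists (wexp N (N - s)); rewrite coef_corr_poly (big_pred1 (- s)) => [|k].
    by rewrite !mulf_neq0 ?conjC_eq0 ?theta_neq0.
  by rewrite corr_exp_large.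
exists (wexp N s); rewrite coef_corr_poly.
under eq_bigl do rewrite corr_exp_small //.
rewrite (bigD1 0) ?eqxx // add0r muln0 expr0 mul1r.
have -> : theta C (0%R : 'I_N) = 1 by [].
rewrite rmorph1 mulr1.
case: (eqVneq (2 * s)%N N) => s2; last first.
  rewrite big1 /= ?addr0 ?theta_neq0 // => k /andP[/orP[/eqP->|]].
    by rewrite eqxx.
  by [].
have s_neq0 : s != 0 by apply/eqP => s0; rewrite s0 in s2.
rewrite (big_pred1 s) => [|k]; last first.
  rewrite -[pred1 s k]/(k == s).
  by case: (eqVneq k s) => [->|_] /=; rewrite ?orbT ?s_neq0 ?orbF ?andbN.
have ss : (s + s)%R = 0 :> 'I_N.
  by apply: val_inj; rewrite /= addnn -mul2n s2 modnn.
rewrite ss /theta /= (negbTE (_ : (s : nat) != 0%N)) // mulr1.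
(* For [2 * s = N] the factor [w ^+ (m * s)] is a sign, and [1 + 'i] plus or minus [1 - 'i] is [2]
   or [2 'i]. *)
have wsq : (w ^+ (m * s)) ^+ 2 = 1.
  by rewrite -exprM -mulnA [(s * 2)%N]mulnC s2 mulnC exprM (prim_expr_order wprim) expr1n.
have -> : (1 + 'i : C)^* = 1 - 'i by rewrite rmorphD /= rmorph1 conjCi.
have /pred2P[-> | ->] : (w ^+ (m * s) == 1) || (w ^+ (m * s) == -1).
  by rewrite -sqrf_eq1 wsq.
- by rewrite mul1r addrACA subrr addr0 -[1 + 1]/(2%:R) pnatr_eq0.
- rewrite (_ : _ + _ = 'i *+ 2); last by ring.
  by rewrite mulrn_eq0 /= neq0Ci.
Qed.

Definition window (rho : nat) (d : 'I_N) : C := (window_poly C n d).[rho%:R].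

Definition good_scale (rho : nat) : Prop :=
  (forall k l : {ffun 'I_N -> 'I_N}, \det (gabor_mx w k l) != 0 ->
     (\det (gabor_mx w k l)).[rho%:R] != 0) /\
  (forall s m, (corr_poly s m).[rho%:R] != 0).

(** Finite functions [k], [l] and ordinals [s], [m] give finitely many nonzero polynomials; a
    nonroot of their product suits them all. *)
Lemma exists_good_scale : exists rho, good_scale rho.
Proof.
pose P := (\prod_(kl : {ffun 'I_N -> 'I_N} * {ffun 'I_N -> 'I_N}
                  | \det (gabor_mx w kl.1 kl.2) != 0) \det (gabor_mx w kl.1 kl.2))
          * \prod_(sm : 'I_N * 'I_N) corr_poly sm.1 sm.2.
have : P != 0.
  by rewrite mulf_neq0 //; apply/prodf_neq0 => // sm _; apply: corr_poly_neq0.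
case/exists_nat_nonroot => rho; rewrite hornerM mulf_eq0 negb_or !horner_prod.
case/andP => /prodf_neq0 /= Hd /prodf_neq0 Hc; exists rho; split.
  by move=> k l kl; apply: (Hd (k, l)).
by move=> s m; apply: (Hc (s, m)).
Qed.

(** Bilinear, with no conjugate on [u]: the fibres of [eta] will carry conjugates, which [cdot]
    undoes. *)
Definition gabor_coef (u : 'I_N -> C) (a : 'I_N -> C) (k l : 'I_N) : C :=
  \sum_(j < N) w ^+ (j * l) * u (j - k) * a j.

(** [N] vanishing coefficients put [a], shifted by the [s] of [rotated_columns], in the left kernel
    of a Gabor matrix that is invertible at a good scale. The shift only costs a power of [w] in
    each column. *)
Lemma window_full_spark rho (a : 'I_N -> C) : good_scale rho ->
  (n < #|[set x : 'I_N * 'I_N | gabor_coef (window rho) a x.1 x.2 == 0%R]|)%N ->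
  forall j, a j = 0.
Proof.
move=> [good _] /card_geqP[L [Luniq Lsize Lsub]].
have [|s [k [l [kmono kle klinj kL]]]] := @rotated_columns n [set:: L].
  by rewrite cardsE (card_uniqP Luniq).
have := good (finfun k) (finfun l).
have -> : gabor_mx w (finfun k) (finfun l) = gabor_mx w k l.
  by apply/matrixP => j c; rewrite !mxE !ffunE.
move=> /(_ (det_gabor_neq0 wprim kmono kle klinj)).
rewrite -[_.[_]]/(horner_eval rho%:R _) -det_map_mx => /det0P detn0 j.
case: (eqVneq (\row_i a (s + i)) 0) => [/rowP/(_ (j - s))|an0].
  by rewrite !mxE addrC subrK.
case: detn0; exists (\row_i a (s + i)) => //; apply/rowP => c.
have := Lsub (s + k c, l c); rewrite -[_ \in L]in_set => /(_ (kL c)).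
rewrite inE => /eqP /= E; rewrite !mxE.
have {}E : w ^+ (s * l c) * \sum_(i < N) w ^+ (i * l c) * window rho (i - k c) * a (s + i) = 0.
  rewrite -[RHS]E /gabor_coef big_distrr /= [RHS](reindex (fun i => s + i)) /=.
    apply: eq_bigr => i _; rewrite prim_exprD !mulrA; congr (_ * window rho _ * _).
    by rewrite opprD addrACA subrr add0r.
  by exists (fun i => i - s) => i _; rewrite 1?addrAC ?subrr ?add0r // addrC subrK.
move/eqP: E; rewrite mulf_eq0 expf_eq0 (prim_root_eq0 wprim) andbF /= => /eqP E.
rewrite -[RHS]E; apply: eq_bigr => i _.
by rewrite !mxE /horner_eval hornerZ mulrC /window -ordBE.
Qed.

Lemma corr_window rho (s m : 'I_N) : (corr_poly s m).[rho%:R] =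
  \sum_(k < N) w ^+ (m * k) * window rho (k + s) * (window rho k)^*.
Proof.
rewrite horner_sum; apply: eq_bigr => k _.
rewrite /window /window_poly !hornerZ !hornerXn rmorphM /= rmorphXn /= conjC_nat.
by rewrite exprD; ring.
Qed.

(* Two Fourier transforms, in the modulation and in the translation variable,
   diagonalise the passage from [a (x) a^*] to the squared moduli. *)
Lemma window_lift rho (a b : 'I_N -> C) : good_scale rho ->
  (forall k l, `|gabor_coef (window rho) a k l| = `|gabor_coef (window rho) b k l|) ->
  forall i j, a i * (a j)^* = b i * (b j)^*.
Proof.
move=> [_ good] ab; set u := window rho in ab.
pose D i j := a i * (a j)^* - b i * (b j)^*.
(* With [i = j + s] in the double sum, the squared modulus becomes a Fourier series in [l], whose
   coefficients can be compared. *)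
have sq (f : 'I_N -> C) k l : `|gabor_coef u f k l| ^+ 2 =
    \sum_(s < N) w ^+ (s * l) * \sum_(j < N) u (j + s - k) * (u (j - k))^* * (f (j + s) * (f j)^*).
  rewrite normCK /gabor_coef rmorph_sum /=.
  under [RHS]eq_bigr do rewrite big_distrr /=.
  rewrite [RHS]exchange_big big_distrr /=; apply: eq_bigr => j _.
  rewrite big_distrl /= (reindex (fun s => j + s)) /=; last first.
    by exists (fun i => i - j) => i _; rewrite 1?addrAC ?subrr ?add0r // addrC subrK.
  apply: eq_bigr => s _; rewrite prim_exprD !rmorphM /=.
  rewrite -[RHS]mul1r -(prim_conj_mul (j * l)); ring.
have D1 s k : \sum_(j < N) u (j + s - k) * (u (j - k))^* * D (j + s) j = 0.
  move: s; apply: fourier_inj => l.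
  have := congr1 (fun x => x ^+ 2) (ab k l); rewrite !sq => /eqP.
  rewrite -subr_eq0 -sumrB => /eqP E; rewrite -[RHS]E; apply: eq_bigr => s _.
  rewrite -mulrBr -sumrB; congr (_ * _); apply: eq_bigr => j _.
  by rewrite -mulrBr.
suff D0 s j : D (j + s) j = 0.
  move=> i j; have := D0 (i - j) j; rewrite addrC subrK => /eqP.
  by rewrite subr_eq0 => /eqP.
apply: (can_inj conjCK); rewrite rmorph0.
move: j; apply: fourier_inj => m.
apply: (can_inj conjCK); rewrite rmorph0; apply/eqP.
have := good s m; rewrite corr_window -/u => cn0; move/mulfI: (cn0) => inj.
apply/eqP/inj; rewrite mulr0.
(* Convolution theorem: the transform in [k] of the sums of [D1] is the value of [corr_poly s m],
   nonzero at a good scale, times the transform of [D (j + s) j] in [j]. *)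
transitivity (\sum_(k < N) (w ^+ (k * m))^*
    * \sum_(j < N) u (j + s - k) * (u (j - k))^* * D (j + s) j); last first.
  by rewrite big1 // => k _; rewrite D1 mulr0.
under [RHS]eq_bigr do rewrite big_distrr /=.
rewrite [RHS]exchange_big rmorph_sum big_distrr /=; apply: eq_bigr => j _.
rewrite big_distrl /= [RHS](reindex (fun k => j - k)) /=; last first.
  by exists (fun i => j - i) => i _; rewrite opprB addrC subrK.
apply: eq_bigr => k _.
have e2 : j - (j - k) = k by rewrite opprB addrC subrK.
have e1 : j + s - (j - k) = k + s by rewrite addrAC e2.
rewrite e1 e2 prim_exprB !rmorphM /= !conjCK [(m * k)%N]mulnC; ring.
Qed.

End Window.

(** * Induced representations *)

Section Cdot.

Variables (R : realType) (n : nat).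
Implicit Types (u v f : 'cV[R[i]]_n) (A : 'M[R[i]]_n).

Lemma cdotE u v : cdot u v = ((v ^t*)%sesqui *m u) 0 0.
Proof. by rewrite mxE; apply: eq_bigr => i _; rewrite !mxE mulrC. Qed.

Lemma cdotZr a u v : cdot u (a *: v) = a^* * cdot u v.
Proof.
rewrite /cdot big_distrr /=; apply: eq_bigr => i _.
by rewrite mxE rmorphM /= mulrCA.
Qed.

Lemma cdotZl a u v : cdot (a *: u) v = a * cdot u v.
Proof. by rewrite /cdot big_distrr /=; apply: eq_bigr => i _; rewrite mxE mulrA. Qed.

Lemma cdot_unitary A u v : A \is unitarymx -> cdot (A *m u) (A *m v) = cdot u v.
Proof.
move=> AU; rewrite !cdotE trmx_mul map_mxM -mulmxA; congr ((_ *m _) 0 0).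
have /unitarymxP AA : (A ^t*)%sesqui \is unitarymx by rewrite trmxC_unitary.
rewrite mulmxA; move: AA; rewrite trmxCK => ->; exact: mul1mx.
Qed.

Lemma cdot_eq0 u : cdot u u = 0 -> u = 0.
Proof.
move=> u0; apply/colP => i; rewrite mxE.
have /eqP := u0; rewrite psumr_eq0 => [/allP/(_ i)|j _]; last exact: mul_conjC_ge0.
by rewrite mem_index_enum mul_conjC_eq0 => /(_ isT)/eqP.
Qed.

End Cdot.

Section Induced.

Variables (R : realType) (gT : finGroupType) (G H : {group gT}) (n m : nat).
Variables (rho : mx_representation R[i] G n) (tau : mx_representation R[i] H m).
Variable T : {linear 'cV[R[i]]_n -> {ffun gT -> 'cV[R[i]]_m}}.
Hypothesis sHG : H \subset G.
Hypothesis T_surj : forall F, ind_space G tau F -> exists v, T v = F.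
Hypothesis T_rho : forall x v, x \in G ->
  T (rho x *m v) = [ffun w => T v (x^-1 * w)%g].

Hypothesis T_isom : forall u v, ind_cdot G H (T u) (T v) = cdot u v.

Lemma T_inj : injective T.
Proof.
move=> u v Tuv; apply/eqP; rewrite -subr_eq0; apply/eqP/cdot_eq0.
rewrite -T_isom linearB Tuv subrr /ind_cdot big1 ?mulr0 // => g _.
by rewrite /cdot big1 // => i _; rewrite ffunE mxE mul0r.
Qed.

Lemma ind_delta (e : 'cV[R[i]]_m) : exists v,
  T v = [ffun g => if g \in H then tau (g^-1)%g *m e else 0].
Proof.
apply: T_surj; split=> [g h gG hH | g gG]; rewrite !ffunE.
  rewrite groupMr //; case: ifP => gH; last by rewrite mulmx0.
  by rewrite invMg repr_mxM ?groupV // mulmxA.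
by have -> : (g \in H) = false by apply: contraNF gG => /(subsetP sHG).
Qed.

(** For [U] invariant under [tau], the functionals [v |-> U *m T v g], with [g] in [G], span an
    invariant row space of [rho]. If [U] is nonzero, this space is everything, which leaves no room
    for a nonzero vector killed by [U]. *)
Lemma ind_irr : mx_irreducible rho -> mx_irreducible tau.
Proof.
move=> [_ n_neq0 rho_irr].
pose M (U : 'M[R[i]]_m) (g : gT) : 'M[R[i]]_(m, n) :=
  \matrix_(i, j) (U *m T (delta_mx j 0) g) i 0.
have ME U g v : M U g *m v = U *m T v g.
  have Ev : v = \sum_j v j 0 *: delta_mx j 0.
    by rewrite {1}[v]matrix_sum_delta; apply: eq_bigr => j _; rewrite big_ord1.
  rewrite {2}Ev linear_sum sum_ffunE mulmx_sumr; apply/colP => i.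
  rewrite mxE summxE; apply: eq_bigr => j _.
  by rewrite linearZ ffunE -scalemxAr !mxE mulrC.
have U_full (U : 'M[R[i]]_m) : mxmodule tau U -> U != 0 -> (1%:M <= U)%MS.
  move=> /mxmoduleP Umod U_neq0.
  pose W := (\sum_(g in G) <<M U g>>)%MS.
  have Wmod : mxmodule rho W.
    apply/mxmoduleP => x xG; rewrite sumsmxMr; apply/sumsmx_subP => g gG.
    rewrite (eqmxMr _ (genmxE _)).
    have -> : M U g *m rho x = M U (x^-1 * g)%g.
      apply/matrixP => i j.
      have := congr1 (fun A : 'cV_m => A i 0) (ME U g (rho x *m delta_mx j 0)).
      by rewrite T_rho // ffunE -ME mulmxA -!colE ![col _ _ _ _]mxE.
    by apply: (sumsmx_sup (x^-1 * g)%g); rewrite ?groupM ?groupV // genmxE.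
  have delta1 e : exists v, T v 1%g = e.
    have [v Tv] := ind_delta e; exists v.
    by rewrite Tv ffunE group1 invg1 repr_mx1 mul1mx.
  have W_neq0 : W != 0.
    apply: contra_neq U_neq0 => W0.
    have M1 : M U 1%g = 0.
      apply/eqP; rewrite -submx0 -W0 -genmxE; exact: (sumsmx_sup 1%g).
    apply/matrixP => i j.
    have [v Tv] := delta1 (delta_mx j 0); have := ME U 1%g v.
    by rewrite M1 mul0mx Tv -colE => /colP/(_ i); rewrite !mxE.
  have /submxP[B BE] := rho_irr W Wmod (submx1 _) W_neq0.
  apply/contraT => nfull.
  have coU : cokermx U != 0 by rewrite cokermx_eq0 -sub1mx.
  have [j cj] : exists j, col j (cokermx U) != 0.
    apply/existsP; apply: contraR coU => /existsPn c0; apply/eqP/matrixP => i j.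
    have := c0 j; rewrite negbK => /eqP/colP/(_ i); by rewrite !mxE.
  (* This vector is supported on [H], and by invariance of [U] all its values are killed by [U]; so
     every row of [W] kills [v]. *)
  have [v Tv] := ind_delta (col j (cokermx U)).
  have UF g : U *m T v g = 0.
    rewrite Tv ffunE; case: ifP => gH; last by rewrite mulmx0.
    have /submxP[D DE] := Umod g^-1%g (groupVr gH).
    by rewrite mulmxA DE -mulmxA colE [U *m _]mulmxA mulmx_coker mul0mx mulmx0.
  have Wv : (W *m v = 0).
    apply/eqP; rewrite -submx0 sumsmxMr_gen; apply/sumsmx_subP => g gG.
    by rewrite genmxE (eqmxMr _ (genmxE _)) ME UF submx0.
  have v0 : v = 0 by rewrite -[v]mul1mx BE -mulmxA Wv mulmx0.
  have := congr1 (fun F : {ffun gT -> 'cV[R[i]]_m} => F 1%g) Tv.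
  rewrite v0 linear0 !ffunE group1 invg1 repr_mx1 mul1mx => E.
  by rewrite -E eqxx in cj.
have m_neq0 : (1%:M : 'M[R[i]]_m) != 0.
  apply: contra_neq n_neq0 => m0.
  have z (v : 'cV[R[i]]_n) : v = 0.
    by apply: T_inj; apply/ffunP => g; rewrite -[LHS]mul1mx -[RHS]mul1mx m0 !mul0mx.
  by apply/matrixP => i j; have /colP/(_ i) := z (col j 1%:M); rewrite !mxE.
split=> //; first exact: mxmodule1.
by move=> U Umod _; apply: U_full.
Qed.

End Induced.

(** * Passage from [tau] to [rho] across one split K-triple *)

Definition zero_set (R : realType) (gT : finGroupType) (G : {group gT})
    (n : nat) (rho : mx_representation R[i] G n) (eta f : 'cV[R[i]]_n) : {set gT} :=
  [set x in G | voice rho eta f x == 0].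

Lemma ltn_add_halves a b e : (2 * a < e -> 2 * b < e -> a + b < e)%N.
Proof. lia. Qed.

Section Step.

Variables (R : realType) (gT : finGroupType) (G H : {group gT}) (n m : nat).
Variables (rho : mx_representation R[i] G n) (tau : mx_representation R[i] H m).
Variable T : {linear 'cV[R[i]]_n -> {ffun gT -> 'cV[R[i]]_m}}.
Hypothesis T_ind : forall v, ind_space G tau (T v).
Hypothesis T_surj : forall F, ind_space G tau F -> exists v, T v = F.
Hypothesis T_rho : forall x v, x \in G ->
  T (rho x *m v) = [ffun w => T v (x^-1 * w)%g].
Hypothesis T_isom : forall u v, ind_cdot G H (T u) (T v) = cdot u v.
Hypothesis nHG : H <| G.
Hypothesis tau_unitary : unitary_repr tau.
Hypothesis tau_irr : mx_irreducible tau.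
Hypothesis rho_faithful : mx_faithful rho.
Variables (d : nat) (x y z : gT).
Local Notation N := d.+1.
Hypothesis xG : x \in G.
Hypothesis yG : y \in G.
Hypothesis zZ : z \in 'Z(G).
Hypothesis xyz : [~ x, y] = z.
Hypothesis xN : (x ^+ N = 1)%g.
Hypothesis oz : #[z]%g = N.
Hypothesis HC : H :=: 'C_G[y].
Hypothesis GH : (G / H)%g = <[coset H x]>%g.
Hypothesis cardGH : #|G / H|%g = N.

Let sHG : H \subset G := normal_sub nHG.
Let xX j : (x ^+ j)%g \in G. Proof. exact: groupX. Qed.
Let xNH j : (x ^+ j)%g \in 'N(H).
Proof. exact: (subsetP (normal_norm nHG)). Qed.

Lemma conj_xX h j : h \in H -> (h ^ (x ^+ j))%g \in H.
Proof. by move=> hH; rewrite memJ_norm. Qed.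

Lemma xX_mem_H (i j : 'I_N) : ((x ^+ i)^-1 * x ^+ j)%g \in H -> i = j.
Proof.
move=> ijH; have ox : #[coset H x]%g = N by rewrite orderE -GH.
have : (coset H x ^+ i = coset H x ^+ j)%g.
  rewrite -!morphX ?(subsetP (normal_norm nHG)) //; apply/eqP.
  by rewrite eq_mulVg1 -morphV ?xNH // -morphM ?groupV ?xNH //= coset_id.
move/eqP; rewrite eq_expg_mod_order ox !modn_small // => /eqP; exact: val_inj.
Qed.

(** Splitness enters here: the powers of [x] are indexed by Z/N, so translating fibres produces no
    correction factor in [H]. *)
Lemma xX_mod j : (x ^+ (j %% N) = x ^+ j)%g.
Proof. by rewrite [in RHS](divn_eq j N) expgD mulnC expgM xN expg1n mul1g. Qed.

Lemma xXB (i j : 'I_N) : ((x ^+ j)^-1 * x ^+ i = x ^+ (i - j)%R)%g.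
Proof.
apply: (mulgI (x ^+ j)%g); rewrite mulgA mulgV mul1g -expgD.
by rewrite -[in LHS](subrK j i) /= xX_mod addnC.
Qed.

Lemma big_cosets (S : Type) (idx : S) (op : Monoid.com_law idx) (F : gT -> S) :
  \big[op/idx]_(g in G) F g
    = \big[op/idx]_(k < N) \big[op/idx]_(h in H) F (h * x ^+ k)%g.
Proof.
pose D := setX H [set: 'I_N].
pose f (p : gT * 'I_N) := (p.1 * x ^+ p.2)%g.
have finj : {in D &, injective f}.
  move=> [h1 k1] [h2 k2]; rewrite !inE !andbT /f /= => h1H h2H E.
  have E' : (x ^+ k1 * (x ^+ k2)^-1 = h1^-1 * h2)%g.
    by apply: (mulgI h1); rewrite mulKVg mulgA E mulgK.
  have k12 : k1 = k2.
    apply/esym/xX_mem_H.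
    have : ((x ^+ k1 * (x ^+ k2)^-1) ^ (x ^+ k2))%g \in H.
      by rewrite conj_xX // E' groupM ?groupV.
    by rewrite conjgE mulgKV.
  by move: E; rewrite k12 => /mulIg ->.
have fD : f @: D = G.
  apply/eqP; rewrite eqEcard; apply/andP; split.
    apply/subsetP => g /imsetP[[h k]]; rewrite inE /= => /andP[hH _] ->.
    by rewrite groupM // (subsetP sHG).
  rewrite card_in_imset // cardsX cardsT card_ord -cardGH.
  by rewrite card_quotient ?normal_norm // Lagrange.
rewrite -fD big_imset //= exchange_big pair_big_dep /=.
by apply: eq_bigl => -[h k]; rewrite !inE !andbT.
Qed.

Lemma ind_left g h v : g \in G -> h \in H -> T v (g * h)%g = tau h^-1%g *m T v g.
Proof. by move=> gG hH; have [-> ] := T_ind v. Qed.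

(** The powers of [x] represent the cosets of [H], and unitarity of [tau] makes the summand of
    [ind_cdot] constant on each. *)
Lemma cdot_fibers u v :
  cdot u v = \sum_(j < N) cdot (T u (x ^+ j)%g) (T v (x ^+ j)%g).
Proof.
rewrite -T_isom /ind_cdot big_cosets /=.
have Hn0 : (#|H|%:R : R[i]) != 0 by rewrite pnatr_eq0 -lt0n cardG_gt0.
apply: (mulfI Hn0); rewrite mulVKf // big_distrr /=; apply: eq_bigr => k _.
rewrite (eq_bigr (fun=> cdot (T u (x ^+ k)%g) (T v (x ^+ k)%g))) => [|h hH].
  by rewrite sumr_const mulr_natl.
rewrite conjgC !ind_left ?conj_xX // cdot_unitary //.
by apply: tau_unitary; rewrite groupV conj_xX.
Qed.

Lemma fiber_inj u v : (forall j : 'I_N, T u (x ^+ j)%g = T v (x ^+ j)%g) -> u = v.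
Proof.
move=> uv; apply/eqP; rewrite -subr_eq0; apply/eqP/cdot_eq0.
rewrite cdot_fibers big1 // => j _; rewrite linearB ffunE /= uv.
by rewrite ffunE subrr /cdot big1 // => i _; rewrite mxE mul0r.
Qed.

Lemma fiber_surj (e : 'I_N -> 'cV[R[i]]_m) :
  exists v, forall j : 'I_N, T v (x ^+ j)%g = e j.
Proof.
have dl j := ind_delta sHG T_surj (e j).
have [v vP] : exists v : 'I_N -> 'cV[R[i]]_n, forall j,
    T (v j) = [ffun g => if g \in H then tau (g^-1)%g *m e j else 0].
  by apply: (fin_all_exists dl).
(* Each [v i] is supported on [H]; [rho (x ^+ i)] moves it to the coset of [x ^+ i]. *)
exists (\sum_(i < N) rho (x ^+ i)%g *m v i) => j.
rewrite linear_sum sum_ffunE (bigD1 j) //= big1 => [|i ij].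
  rewrite addr0 T_rho // ffunE vP ffunE mulVg group1 invg1 repr_mx1.
  exact: mul1mx.
rewrite T_rho // ffunE vP ffunE; case: ifP => // /xX_mem_H ijE.
by rewrite ijE eqxx in ij.
Qed.

Let m_gt0 : (0 < m)%N.
Proof. by have [_ + _] := tau_irr; case: m => // /eqP[]; apply/matrixP => -[]. Qed.

(** Schur's lemma. *)
Lemma tau_scalar h : h \in H -> (forall g, g \in H -> commute g h) ->
  exists2 c, tau h = c%:M & c != 0.
Proof.
move=> hH hC.
have /is_scalar_mxP[c cE] : is_scalar_mx (tau h).
  apply: (mx_abs_irr_cent_scalar (group_closure_closed_field tau_irr)).
  by apply/centgmxP => g gH; rewrite -!repr_mxM // hC.
exists c => //; apply: contraTneq (repr_mx_unit tau hH) => c0.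
by rewrite cE c0 unitmxE det_scalar expr0n eqn0Ngt m_gt0 unitr0.
Qed.

Let zG : z \in G. Proof. by have /setIP[] := zZ. Qed.
Let zC g : g \in G -> commute g z.
Proof. by move=> gG; have /setIP[_ /centP] := zZ; move=> /(_ _ gG) E; rewrite /commute E. Qed.
Let zH : z \in H.
Proof. by rewrite HC inE zG; apply/cent1P; apply/esym/zC. Qed.
Let yH : y \in H. Proof. by rewrite HC inE yG cent1id. Qed.
Let yC h : h \in H -> commute h y.
Proof. by rewrite HC => /setIP[_ /cent1P]. Qed.

Lemma tau_scalarX h c i : h \in H -> tau h = c%:M -> tau (h ^+ i)%g = (c ^+ i)%:M.
Proof.
move=> hH cE; elim: i => [|i IH]; first by rewrite expg0 repr_mx1.
by rewrite expgS repr_mxM ?groupX // cE IH -scalar_mxM exprS.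
Qed.

(** If [k] is the order of the scalar [c], the central element [z ^+ k] acts trivially on every
    fibre, hence lies in the kernel of [rho]; faithfulness gives [N %| k]. *)
Lemma tau_z : exists2 c, tau z = c%:M & N.-primitive_root c.
Proof.
have [c cE _] := tau_scalar zH (fun g gH => zC (subsetP sHG _ gH)).
have tauX i := tau_scalarX i zH cE.
exists c => //.
have cN : c ^+ N = 1.
  have := tauX N; rewrite -oz expg_order repr_mx1 => /matrixP.
  by move=> /(_ (Ordinal m_gt0) (Ordinal m_gt0)); rewrite !mxE eqxx !mulr1n => ->.
have [k kprim kN] := prim_order_exists (ltn0Sn d) cN.
suff -> : N = k by [].
apply/eqP; rewrite eqn_dvd kN andbT -oz order_dvdn -in_set1.
apply: (subsetP rho_faithful); rewrite inE groupX //=; apply/eqP/matrixP.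
have E (v : 'cV[R[i]]_n) : rho (z ^+ k)%g *m v = v.
  apply: fiber_inj => j; rewrite T_rho ?groupX // ffunE.
  have -> : ((z ^+ k)^-1 * x ^+ j = x ^+ j * (z ^+ k)^-1)%g.
    exact: esym (commuteV (commuteX k (zC (xX j)))).
  rewrite ind_left ?groupV ?groupX // invgK tauX (prim_expr_order kprim).
  exact: mul1mx.
by move=> i j; rewrite mul1mx -[rho _]mulmx1; have /colP/(_ i) := E (col j 1%:M);
  rewrite colE mulmxA -!colE !mxE.
Qed.

(** [z] is central, so each conjugation by [x] contributes one factor [z^-1]. This makes [y] act as
    a modulation across the fibres. *)
Lemma y_conj j : (y ^ (x ^+ j) = y * (z ^+ j)^-1)%g.
Proof.
elim: j => [|j IH]; first by rewrite !expg0 conjg1 invg1 mulg1.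
have yx : (y ^ x = y * z^-1)%g.
  by rewrite -xyz invg_comm commgEl mulKVg.
rewrite expgSr conjgM IH conjMg yx conjVg conjXg.
have -> : (z ^ x = z)%g by apply/conjg_fixP/commgP/commute_sym/zC.
by rewrite -mulgA -invMg -expgSr.
Qed.

Variables (c : R[i]) (u : 'I_N -> R[i]).
Variables (zeta : 'cV[R[i]]_m) (eta : 'cV[R[i]]_n).
Hypothesis cE : tau z = c%:M.
Hypothesis cprim : N.-primitive_root c.
Hypothesis u_spark : forall a : 'I_N -> R[i],
  (d < #|[set kl : 'I_N * 'I_N | gabor_coef c u a kl.1 kl.2 == 0%R]|)%N ->
  forall j, a j = 0.
Hypothesis u_lift : forall a b : 'I_N -> R[i],
  (forall k l, `|gabor_coef c u a k l| = `|gabor_coef c u b k l|) ->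
  forall i j, a i * (a j)^* = b i * (b j)^*.
Hypothesis etaE : forall j : 'I_N, T eta (x ^+ j)%g = (u j)^* *: zeta.

Definition fiber_voice (f : 'cV[R[i]]_n) (h : gT) (j : 'I_N) : R[i] :=
  voice tau zeta (T f (x ^+ j)%g) (h ^ (x ^+ j))%g.

Lemma voice_fibers f h (k : 'I_N) : h \in H ->
  voice rho eta f (h * x ^+ k)%g = \sum_(j < N) u (j - k) * fiber_voice f h j.
Proof.
move=> hH; rewrite /voice cdot_fibers; apply: eq_bigr => j _.
have hG := subsetP sHG _ hH.
rewrite T_rho ?groupM // ffunE.
(* Moving [h^-1] to the right of [x ^+ j] conjugates it and leaves the translation [j - k] modulo
   [N]. *)
have -> : ((h * x ^+ k)^-1 * x ^+ j = x ^+ (j - k)%R * (h ^ (x ^+ j))^-1)%g.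
  by rewrite -xXB invMg -mulgA -conjVg conjgE !mulgA mulgK.
rewrite ind_left ?groupV ?conj_xX // invgK etaE -scalemxAr cdotZr conjCK.
by [].
Qed.

(** [y] is central in [H], so [tau y] is a scalar [a]; on fibre [j] it becomes [a * (c ^+ j)^*], and
    [cdot] conjugates its [l]-th power into [a^* ^+ l * c ^+ (j * l)]. *)
Lemma voice_gabor : exists2 l0 : R[i], l0 != 0
  & forall f h (k l : 'I_N), h \in H -> voice rho eta f (y ^+ l * (h * x ^+ k))%g
      = l0 ^+ l * gabor_coef c u (fiber_voice f h) k l.
Proof.
have [a aE a_neq0] := tau_scalar yH yC.
exists a^*; rewrite ?conjC_eq0 // => f h k l hH.
rewrite mulgA voice_fibers ?groupM ?groupX // /gabor_coef big_distrr /=.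
apply: eq_bigr => j _.
have -> : fiber_voice f (y ^+ l * h)%g j = a^* ^+ l * c ^+ (j * l) * fiber_voice f h j.
  rewrite /fiber_voice /voice conjMg conjXg y_conj.
  have zjH : ((z ^+ j)^-1)%g \in H by rewrite groupV groupX.
  have yzE : tau (y * (z ^+ j)^-1)%g = (a * (c ^+ j)^*)%:M.
    rewrite repr_mxM // aE repr_mxV ?groupX // (tau_scalarX _ zH cE) invmx_scalar.
    rewrite -scalar_mxM; congr (_ * _)%:M.
    have cj := prim_conj_mul cprim j.
    have cj_neq0 : c ^+ j != 0 by rewrite expf_eq0 (prim_root_eq0 cprim) andbF.
    by apply: (mulfI cj_neq0); rewrite cj mulfV.
  have yzH : (y * (z ^+ j)^-1)%g \in H by rewrite groupM.
  rewrite repr_mxM ?groupX ?conj_xX // (tau_scalarX l yzH yzE).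
  rewrite -mulmxA mul_scalar_mx cdotZr; congr (_ * _).
  by rewrite rmorphXn rmorphM /= conjCK exprMn -exprM.
ring.
Qed.

Lemma card_zero_fiber f (j : 'I_N) :
  (\sum_(h in H) (fiber_voice f h j == 0%R) = #|zero_set tau zeta (T f (x ^+ j)%g)|)%N.
Proof.
rewrite card_set_sum [RHS](reindex_inj (conjg_inj (x ^+ j)%g)) /=.
by apply: eq_bigl => h; rewrite memJ_norm.
Qed.

(** Each [h] contributes at most [d] vanishing Gabor coefficients, unless all fibre values at [h]
    vanish. Then it contributes at most [N * N], and [h] is counted among the zeros of fibre [j]. *)
Lemma zero_set_count f (j : 'I_N) :
  (N * #|zero_set rho eta f|
    <= #|H| * d + N * N * #|zero_set tau zeta (T f (x ^+ j)%g)|)%N.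
Proof.
have [l0 l0_neq0 vE] := voice_gabor.
pose Z (h : gT) :=
  #|[set kl : 'I_N * 'I_N | gabor_coef c u (fiber_voice f h) kl.1 kl.2 == 0%R]|.
have -> : (N * #|zero_set rho eta f| = \sum_(h in H) Z h)%N.
  rewrite card_set_sum -[N in LHS]card_ord -sum_nat_const.
  (* Translation by [y ^+ l] permutes [G], so the [N] copies of the zero count can run through the
     [N] modulations. *)
  transitivity (\sum_(l < N) \sum_(k < N) \sum_(h in H)
                  (gabor_coef c u (fiber_voice f h) k l == 0%R))%N.
    apply: eq_bigr => l _; rewrite (reindex_inj (mulgI (y ^+ l)%g)) /=.
    under eq_bigl => g do rewrite groupMl ?groupX //.
    rewrite big_cosets; apply: eq_bigr => k _; apply: eq_bigr => h hH.
    by rewrite vE // mulf_eq0 expf_eq0 (negbTE l0_neq0) andbF.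
  rewrite exchange_big; under eq_bigr do rewrite exchange_big.
  rewrite exchange_big; apply: eq_bigr => h hH /=.
  rewrite /Z (_ : [set _ | _] = [set kl in setT
     | gabor_coef c u (fiber_voice f h) kl.1 kl.2 == 0%R]); last first.
    by apply/setP => kl; rewrite !inE.
  rewrite card_set_sum pair_bigA /=; apply: eq_bigl => kl; by rewrite inE.
rewrite -card_zero_fiber -sum_nat_const big_distrr /= -big_split /=.
apply: leq_sum => h hH; case: (ltnP d (Z h)) => Zh; last first.
  by apply: (leq_trans Zh); apply: leq_addr.
rewrite (u_spark Zh) eqxx muln1; apply: (leq_trans (max_card _)).
by rewrite card_prod card_ord leq_addl.
Qed.

Lemma vector_phase_retrieval_step :
  vector_phase_retrieval tau zeta ->
  (forall f, f != 0 -> (2 * #|zero_set tau zeta f| < #|H|)%N) ->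
  vector_phase_retrieval rho eta.
Proof.
move=> PR few f g fg.
have [l0 l0_neq0 vE] := voice_gabor.
have lift h : h \in H -> forall i j, fiber_voice f h i * (fiber_voice f h j)^*
    = fiber_voice g h i * (fiber_voice g h j)^*.
  move=> hH; apply: u_lift => k l.
  have hkG : (y ^+ l * (h * x ^+ k))%g \in G.
    by rewrite groupM ?groupX // groupM // (subsetP sHG).
  have := fg _ hkG; rewrite !vE // !normrM; apply: mulfI.
  by rewrite normr_eq0 expf_eq0 (negbTE l0_neq0) andbF.
have phase (j : 'I_N) : exists b : R[i],
    `|b| = 1 /\ T f (x ^+ j)%g = b *: T g (x ^+ j)%g.
  apply: PR => h hH.
  (* The point is chosen to undo the conjugation in [fiber_voice]; the diagonal products then give
     the moduli of the fibre transforms. *)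
  have hH' : (h ^ (x ^+ j)^-1)%g \in H by rewrite memJ_norm // groupV.
  have := lift _ hH' j j; rewrite -!normCK /fiber_voice conjgKV => /eqP.
  by rewrite eqrXn2 ?normr_ge0 // => /eqP.
have [b bP] := fin_all_exists phase.
have common (i j : 'I_N) : T g (x ^+ i)%g != 0 -> T g (x ^+ j)%g != 0 -> b i = b j.
  move=> gi gj.
  have [h hH /andP[hi hj]] : exists2 h, h \in H
      & (fiber_voice g h i != 0) && (fiber_voice g h j != 0).
    apply/exists_inP; apply/contraT => /exists_inPn none.
    have : (#|H| <= #|zero_set tau zeta (T g (x ^+ i)%g)|
                     + #|zero_set tau zeta (T g (x ^+ j)%g)|)%N.
      rewrite -!card_zero_fiber -big_split /= -sum1_card; apply: leq_sum => h hH.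
      have := none h hH; move: (fiber_voice g h i) (fiber_voice g h j) => v1 v2.
      by case: (v1 == 0); case: (v2 == 0).
    by rewrite leqNgt ltn_add_halves ?few.
  have Ab k h' : fiber_voice f h' k = b k * fiber_voice g h' k.
    by rewrite /fiber_voice /voice (bP k).2 cdotZl.
  have := lift h hH i j; rewrite !Ab rmorphM /= mulrACA => /eqP.
  rewrite -subr_eq0 -[X in _ - X]mul1r -mulrBl mulf_eq0.
  have ij_neq0 : fiber_voice g h i * (fiber_voice g h j)^* != 0.
    by move: hj; rewrite -conjC_eq0; apply: mulf_neq0.
  rewrite (negbTE ij_neq0) orbF subr_eq0 => /eqP bij; rewrite -[b i]mulr1 -[1](_ : b j * (b j)^* = 1).
    by rewrite mulrCA bij mulr1.
  by rewrite -normCK (bP j).1 expr1n.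
(* Vanishing fibres of [g] accept any phase, so the phase of one nonzero fibre serves all; if there
   is none, [f] and [g] are both zero. *)
case: (pickP (fun j : 'I_N => T g (x ^+ j)%g != 0)) => [j0 gj0 | g0].
  exists (b j0); split; first exact: (bP j0).1.
  apply: fiber_inj => j; rewrite linearZ ffunE (bP j).2.
  case: (eqVneq (T g (x ^+ j)%g) 0) => [-> | gj]; first by rewrite !scaler0.
  by rewrite (common j j0).
exists 1; split; first exact: normr1.
apply: fiber_inj => j; rewrite (bP j).2 scale1r.
by have /negbFE/eqP -> := g0 j; rewrite scaler0.
Qed.

End Step.

(** * Iterating over the full sequence *)

Definition level_density (R : realType) (p r : nat) : R :=
  (p%:R ^+ r - 1) / p%:R ^+ (2 * r).

Lemma level_density_ge0 (R : realType) p r : prime p -> 0 <= level_density R p r.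
Proof.
move=> p_pr; rewrite /level_density divr_ge0 ?exprn_ge0 // subr_ge0.
by rewrite exprn_ege1 // ler1n prime_gt0.
Qed.

(** The inequality of [zero_set_count] divided by [N * N * h], where [N = d.+1], [h] is the order of
    [H] and [N * h] that of [G]. *)
Lemma density_bound (R : realFieldType) (d a b h : nat) (delta : R) :
  b%:R <= delta * h%:R -> (d.+1 * a <= h * d + d.+1 * d.+1 * b)%N ->
  a%:R <= ((d.+1%:R - 1) / d.+1%:R ^+ 2 + delta) * (d.+1 * h)%:R.
Proof.
move=> bh; rewrite -(ler_nat R) natrD !natrM -!natr1.
have N_gt0 : 0 < d%:R + 1 :> R by rewrite natr1 ltr0n.
move: (d%:R : R) N_gt0 => e N_gt0 cnt.
rewrite -(ler_pM2l N_gt0); apply: (le_trans cnt).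
have -> : (e + 1) * (((e + 1 - 1) / (e + 1) ^+ 2 + delta) * ((e + 1) * h%:R))
    = h%:R * e + (e + 1) * (e + 1) * (delta * h%:R).
  by field; rewrite gt_eqF.
by rewrite lerD2l ler_pM2l // mulr_gt0.
Qed.

(** [eta] is chosen before [delta], so the same vector satisfies the density estimate and does phase
    retrieval. *)
Lemma K_triple_step (R : realType) (p : nat) (gT : finGroupType) (G H : {group gT})
    (n m r : nat) (rho : mx_representation R[i] G n)
    (tau : mx_representation R[i] H m) :
  prime p -> K_triple p rho r tau -> K_split p G H r ->
  mx_irreducible tau /\ forall zeta, exists eta,
    (forall delta : R,
       (forall f, f != 0 -> #|zero_set tau zeta f|%:R <= delta * #|H|%:R) ->
       forall f, f != 0 ->
         #|zero_set rho eta f|%:R <= (level_density R p r + delta) * #|G|%:R) /\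
    (vector_phase_retrieval tau zeta ->
     (forall f, f != 0 -> (2 * #|zero_set tau zeta f| < #|H|)%N) ->
     vector_phase_retrieval rho eta).
Proof.
move=> p_pr [[_ _ rho_irr faith] nHG tauU [T [T_ind T_surj T_isom T_rho]] _].
move=> [x [y [z [[[xG yZ zZ] [xyz zE isoz] HC [GH isoGH]] xq]]]].
have tau_irr := ind_irr (normal_sub nHG) T_surj T_rho T_isom rho_irr.
split=> // zeta.
have q_gt0 : (0 < p ^ r)%N by rewrite expn_gt0 prime_gt0.
have oz : #[z]%g = (p ^ r)%N by rewrite orderE (card_isog isoz) card_Zp.
have cGH : #|G / H|%g = (p ^ r)%N by rewrite (card_isog isoGH) card_Zp.
have yG : y \in G by move: yZ; rewrite !inE => /andP[_ /andP[]].
have pE : (p%:R ^+ r : R) = (p ^ r)%:R by rewrite natrX.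
rewrite /level_density mulnC exprM pE.
(* The successor form gives the ordinals their additive group structure of Z/N. *)
case: (p ^ r)%N q_gt0 oz cGH xq => // d _ oz cGH xq.
have [c cE cprim] := tau_z T_ind T_rho T_isom nHG tauU tau_irr faith xG yG zZ oz HC GH cGH.
have [s s_good] := exists_good_scale cprim.
pose u := window R[i] s : 'I_d.+1 -> R[i].
have [eta etaE] := fiber_surj T_surj T_rho nHG xG GH cGH (fun j : 'I_d.+1 => (u j)^* *: zeta).
exists eta; split.
- move=> delta small f f_neq0.
  have [j fj] : exists j : 'I_d.+1, T f (x ^+ j)%g != 0.
    apply/existsP; apply: contraR f_neq0 => /existsPn f0; apply/eqP.
    apply: (fiber_inj T_ind T_isom nHG tauU xG GH cGH) => j.
    by have := f0 j; rewrite negbK => /eqP ->; rewrite linear0 ffunE.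
  have := zero_set_count T_ind T_rho T_isom nHG tauU tau_irr xG yG zZ xyz xq HC GH
            cGH cE cprim (fun a => window_full_spark cprim s_good) etaE f j.
  have := small _ fj.
  have GE : (#|G| = d.+1 * #|H|)%N.
    by rewrite -cGH card_quotient ?normal_norm // mulnC Lagrange ?normal_sub.
  by rewrite GE => tau_small cnt; apply: density_bound tau_small cnt.
- move=> PR few.
  apply: (vector_phase_retrieval_step T_ind T_rho T_isom nHG tauU tau_irr xG yG zZ xyz xq HC GH
            cGH cE cprim _ etaE) => // a b ab; exact: window_lift s_good ab.
Qed.

Lemma voice_kquo (R : realType) (gT : finGroupType) (G : {group gT}) (n : nat)
    (rho : mx_representation R[i] G n) eta f x : x \in G ->
  voice (kquo_repr rho) eta f (coset (rker rho) x) = voice rho eta f x.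
Proof. by move=> xG; rewrite /voice kquo_repr_coset. Qed.

(** The voice transform is constant on cosets of the kernel, so the proportion of zeros is the same
    for the quotient. *)
Lemma card_zero_set_kquo (R : realType) (gT : finGroupType) (G : {group gT}) (n : nat)
    (rho : mx_representation R[i] G n) eta f :
  #|zero_set rho eta f| = (#|rker rho| * #|zero_set (kquo_repr rho) eta f|)%N.
Proof.
have nKG := rker_normal rho; have sGN := subsetP (normal_norm nKG).
rewrite [LHS]card_set_sum [X in (_ * X)%N]card_set_sum big_distrr /=.
rewrite (partition_big (coset (rker rho)) [in (G / rker rho)%g]) /= => [|x xG]; last first.
  exact: mem_quotient.
apply: eq_bigr => _ /morphimP[x0 x0N x0G ->] /=.
rewrite (eq_bigr (fun=> voice (kquo_repr rho) eta f (coset (rker rho) x0) == 0%R : nat)).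
  rewrite sum_nat_const; congr (_ * _)%N; rewrite -[RHS](card_rcoset (rker_group rho) x0).
  apply: eq_card => x; rewrite -cosetpre_set1 // unfold_in.
  apply/andP/morphpreP => [[xG /eqP xx0] | [xN /set1P xx0]].
    by split; [apply: sGN | apply/set1P].
  split; last exact/eqP.
  rewrite -(quotientGK nKG); apply/morphpreP; split=> //.
  by rewrite xx0 mem_quotient.
by move=> x /andP[xG /eqP <-]; rewrite voice_kquo.
Qed.

(** The end of the sequence: in dimension one the voice transform is the coordinate of [f] times a
    nowhere vanishing function on [G]. *)
Lemma linear_repr_voice (R : realType) (gT : finGroupType) (G : {group gT}) (n : nat)
    (rho : mx_representation R[i] G n) : n = 1%N -> unitary_repr rho ->
  exists eta, (forall f, f != 0 -> zero_set rho eta f = set0) /\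
    vector_phase_retrieval rho eta.
Proof.
move=> n1 rhoU; subst n.
exists (const_mx 1).
have vE f x : voice rho (const_mx 1) f x = f 0 0 * (rho x 0 0)^*.
  by rewrite /voice /cdot big_ord1 mxE big_ord1 [const_mx _ _ _]mxE mulr1.
split=> [f f_neq0 | f g fg].
  apply/setP => x; rewrite !inE; apply/negbTE/negP => /andP[xG].
  rewrite vE mulf_eq0 conjC_eq0 => /orP[/eqP f0 | /eqP r0].
    by case/eqP: f_neq0; apply/matrixP => i j; rewrite !ord1 f0 mxE.
  have := repr_mx_unit rho xG; rewrite unitmxE det_mx11 r0 unitr0 //.
have := fg 1%g (group1 G); rewrite !vE repr_mx1 !mxE eqxx rmorph1 !mulr1 => nfg.
case: (eqVneq (g 0 0) 0) => [g0 | g0].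
  exists 1; split; first exact: normr1.
  apply/matrixP => i j; rewrite !ord1 mxE g0 mulr0; apply/eqP.
  by rewrite -normr_eq0 nfg g0 normr0.
exists (f 0 0 / g 0 0); split; first by rewrite normf_div nfg divff // normr_eq0.
by apply/matrixP => i j; rewrite !ord1 mxE divfK.
Qed.

(** Both claims must hold for one [eta], since phase retrieval at a level uses the zero density of
    the same vector one level deeper. That density involves only the triples after the first, hence
    [behead]. *)
Lemma full_sequence_window (R : realType) (p : nat) (gT : finGroupType)
    (G : {group gT}) (n : nat) (rho : mx_representation R[i] G n)
    (s : full_sequence p rho) :
  prime p -> unitary_repr rho -> mx_irreducible rho -> all_split s ->
  exists eta,
    (forall f, f != 0 -> #|zero_set rho eta f|%:R
       <= (\sum_(r <- seq_r s) level_density R p r) * #|G|%:R) /\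
    (\sum_(r <- behead (seq_r s)) level_density R p r < 1 / 2 ->
     vector_phase_retrieval rho eta).
Proof.
move=> p_pr; elim: s => {gT G n rho} [gT G n rho abG | gT G n rho H r m tau Ktri s IH].
  move=> rhoU rho_irr _.
  (* An abelian quotient puts the derived subgroup in the kernel, which forces an irreducible
     representation to have degree one. *)
  have /eqP n1 : n == 1%N.
    rewrite -(der1_sub_rker _ rho_irr) ?der1_min ?rker_norm //.
    exact: group_closure_closed_field.
  have [eta [zero0 PR]] := linear_repr_voice n1 rhoU.
  by exists eta; split=> // f f_neq0; rewrite zero0 // cards0 big_nil mul0r.
move=> rhoU rho_irr /= [split_K split_s].
have [_ _ tauU _ _] := Ktri.
have [tau_irr step] := K_triple_step p_pr Ktri split_K.
have [zeta [small PRtau]] := IH tauU tau_irr split_s.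
have [eta [small_eta PReta]] := step zeta.
exists eta; split.
  move=> f f_neq0; rewrite big_cons.
  have small_f := small_eta _ small f f_neq0.
  have GE : (#|G| = #|rker rho| * #|G / rker rho|%g)%N.
    by rewrite card_quotient ?rker_norm // (Lagrange (normal_sub (rker_normal rho))).
  rewrite card_zero_set_kquo GE !natrM [X in _ <= X]mulrCA.
  exact: ler_wpM2l small_f.
move=> dens; suff : vector_phase_retrieval (kquo_repr rho) eta.
  move=> PR f g fg; apply: PR => _ /morphimP[x _ xG ->].
  by rewrite !voice_kquo // fg.
apply: PReta.
  (* One level deeper the sum loses its first term, which is nonnegative, so the bound by one half
     persists. *)
  apply: PRtau; apply: le_lt_trans dens; case: (seq_r s) => [|r' rs] /=.
    by rewrite big_nil.
  by rewrite [X in _ <= X]big_cons lerDr level_density_ge0.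
(* The sum bounds the proportion of zeros for [tau], and it is below one half. *)
move=> f f_neq0; have := small f f_neq0.
rewrite -(ltr_nat R) natrM => le_dens.
have H_gt0 : 0 < #|H|%:R :> R by rewrite ltr0n cardG_gt0.
nra.
Qed.

Theorem corollary33 (R : realType) (p : nat) (gT : finGroupType)
    (G : {group gT}) (n : nat) (rho : mx_representation R[i] G n)
    (s : full_sequence p rho) :
  prime p ->
  nontrivial_pgroup p G ->
  unitary_repr rho ->
  mx_irreducible rho ->
  all_split s ->
  \sum_(r <- behead (seq_r s)) (p%:R ^+ r - 1) / p%:R ^+ (2 * r)
    < 1 / 2 :> R ->
  phase_retrieval rho.
Proof.
move=> p_pr _ rhoU rho_irr split_s dens.
have [eta [_ PR]] := full_sequence_window p_pr rhoU rho_irr split_s.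
by exists eta; apply: PR.
Qed.
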